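(* $T_3$ does not contain any element of order two; hence $T_3$ is not isomorphic to $\vec T$.
   Context: **$T_3$.** $T_3$ is the group of homeomorphisms of the circle $[0,1]/(0\sim1)$ that are piecewise linear with finitely many breakpoints, all at $3$-adic rationals (elements of $\mathbb Z[1/3]$), with slopes integer powers of $3$, and that map $3$-adic rationals to $3$-adic rationals. Equivalently, its elements are those represented by triples $(R,S,n)$ of full ternary trees ($0$ or $3$ children at each vertex, the children of a vertex with interval $[a,b)$ getting the left, middle and right thirds of $[a,b)$) with the same number of leaves, exactly as described below for binary trees. **Trees and $T$.** A full binary tree is a finite rooted plane tree in which every vertex has either $0$ children or $2$ children (a left and a right one); leaves are numbered $1,2,\dots$ from left to right. Associate $[0,1)$ with the root, and if $[a,b)$ is associated with a vertex, associate $[a,\frac{a+b}2)$ with its left child and $[\frac{a+b}2,b)$ with its right child. Given full binary trees $R,S$ with the same number $m$ of leaves and $1\le n\le m$, the triple $(R,S,n)$ represents the homeomorphism of the circle $[0,1]/(0\sim 1)$ which, for each $i$, maps the interval of leaf $i$ of $R$ affinely and increasingly onto the interval of leaf $i+n-1$ (taken mod $m$ in $\{1,\dots,m\}$) of $S$; leaf $i$ of $R$ is said to be identified with leaf $i+n-1$ of $S$. Thompson's group $T$ is the group of all homeomorphisms so represented. A triple is reduced if there is no caret in $R$ both of whose children are leaves that are identified (left with left, right with right) with the two leaf children of a caret of $S$; every element of $T$ has a unique reduced triple. **Thompson graphs.** For a full binary tree with leaves $l_1,\dots,l_m$ arranged on a horizontal line, its Thompson graph has vertices $v_1,\dots,v_m$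 on that line, $v_1$ to the left of $l_1$ and $v_i$ between $l_{i-1}$ and $l_i$; for each left edge $e$ of the tree, the unique pair $v_i,v_j$ that can be joined by a path above the line crossing the tree only at $e$ is joined by an edge. (Equivalently: for each non-leaf vertex $p$, join $v_i$ to $v_j$ where $l_i$ is the leftmost leaf below the left child of $p$ and $l_j$ is the leftmost leaf below the right child of $p$.) The Thompson graph of $f\in T$ with reduced triple $(R,S,n)$ is obtained from the Thompson graphs of $R$ and $S$ by identifying their vertices in the same way as the leaves (the $i$th vertex for $R$ with the $(i+n-1)$st, mod $m$, for $S$). $\vec T$ is the subgroup of all $f\in T$ whose Thompson graph is bipartite. *)

(* Defs.v *)
From HB Require Import structures.
From mathcomp Require Import all_boot all_order all_algebra generic_quotient.
From mathcomp Require Import all_classical all_reals all_analysis.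

Set Implicit Arguments.
Unset Strict Implicit.
Unset Printing Implicit Defensive.
Import Order.TTheory GRing.Theory Num.Theory.
Import numFieldNormedType.Exports.
Local Open Scope classical_set_scope.
Local Open Scope ring_scope.
Local Open Scope quotient_scope.

Section Homeomorphisms.
Variable X : topologicalType.

Definition homeomorphism (f : X -> X) : Prop :=
  exists g : X -> X,
    [/\ cancel f g, cancel g f, continuous f & continuous g].

Record homeo := Homeo {
  homeo_fun :> X -> X;
  homeoP : homeomorphism homeo_fun }.

HB.instance Definition _ := gen_eqMixin homeo.
HB.instance Definition _ := gen_choiceMixin homeo.

Lemma homeo_inj (f g : homeo) : (f : X -> X) =1 g -> f = g.
Proof.
case: f g => [f Hf] [g Hg] /= /funext fg.
by case: _ / fg Hg => Hg; congr Homeo; exact: Prop_irrelevance.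
Qed.

Fact homeo_one_subproof : homeomorphism (@idfun X).
Proof. by exists idfun; split => // x; exact: cvg_id. Qed.

Definition homeo_one := Homeo homeo_one_subproof.

Fact homeo_mul_subproof (f g : homeo) : homeomorphism (f \o g).
Proof.
case: f g => [f /= [f' [ff' f'f cf cf']]] [g /= [g' [gg' g'g cg cg']]].
exists (g' \o f'); split.
- exact: can_comp.
- exact: can_comp.
- by move=> x; apply: continuous_comp; [exact: cg|exact: cf].
- by move=> x; apply: continuous_comp; [exact: cf'|exact: cg'].
Qed.

Definition homeo_mul (f g : homeo) := Homeo (homeo_mul_subproof f g).

Definition homeo_inv_fun (f : homeo) : X -> X := sval (cid (homeoP f)).

Fact homeo_inv_subproof (f : homeo) : homeomorphism (homeo_inv_fun f).
Proof.
rewrite /homeo_inv_fun; case: cid => g /= [fg gf cf cg].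
by exists f; split.
Qed.

Definition homeo_inv (f : homeo) := Homeo (homeo_inv_subproof f).

Fact homeo_mulA : associative homeo_mul.
Proof. by move=> f g h; exact: homeo_inj. Qed.

Fact homeo_mul1 : left_id homeo_one homeo_mul.
Proof. by move=> f; exact: homeo_inj. Qed.

Fact homeo_mulr1 : right_id homeo_one homeo_mul.
Proof. by move=> f; exact: homeo_inj. Qed.

Fact homeo_mulV : left_inverse homeo_one homeo_inv homeo_mul.
Proof.
move=> f; apply: homeo_inj => x /=.
by rewrite /homeo_inv_fun; case: cid => g /= [fg _ _ _]; exact: fg.
Qed.

Fact homeo_mulrV : right_inverse homeo_one homeo_inv homeo_mul.
Proof.
move=> f; apply: homeo_inj => x /=.
by rewrite /homeo_inv_fun; case: cid => g /= [_ gf _ _]; exact: gf.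
Qed.

HB.instance Definition _ := isGroup.Build homeo
  homeo_mulA homeo_mul1 homeo_mulr1 homeo_mulV homeo_mulrV.

End Homeomorphisms.

Definition has_order (G : groupType) (n : nat) (g : G) : Prop :=
  (g ^+ n = 1)%g /\ forall m : nat, (0 < m < n)%N -> (g ^+ m <> 1)%g.

(* Isomorphism of subgroups A of G and B of H; phi is irrelevant outside A. *)
Definition isomorphic (G H : groupType) (A : set G) (B : set H) : Prop :=
  exists phi : G -> H, set_bij A B phi /\
    forall x y : G, A x -> A y -> phi (x * y)%g = (phi x * phi y)%g.

Section Circle.
Variable R : realType.

Definition circle_rel (x y : R) : bool := x - y \is a Num.int.

Fact circle_rel_refl : reflexive circle_rel.
Proof. by move=> x; rewrite /circle_rel subrr rpred0. Qed.

Fact circle_rel_sym : symmetric circle_rel.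
Proof. by move=> x y; rewrite /circle_rel -opprB rpredN. Qed.

Fact circle_rel_trans : transitive circle_rel.
Proof.
move=> y x z; rewrite /circle_rel => xy yz.
by rewrite -(subrK y x) -addrA rpredD.
Qed.

Canonical circle_equiv :=
  EquivRel circle_rel circle_rel_refl circle_rel_sym circle_rel_trans.

(* The circle [0,1]/(0~1), as R/Z with the quotient topology: [0,1] is a
   fundamental domain whose endpoints are the only points identified. *)
Definition circle : topologicalType :=
  quotient_topology {eq_quot circle_equiv}.

Definition circle_pi (t : R) : circle :=
  \pi_({eq_quot circle_equiv}) t.

Definition triadic (x : R) : Prop :=
  exists (p : int) (k : nat), x = p%:~R / 3 ^+ k.

(* The subdivision 0 = s_0 < s_1 < ... < s_m = 1 contains all breakpoints.
   Affine pieces are taken in the circle, hence read modulo 1. *)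
Definition triadic_piecewise_linear (f : circle -> circle) : Prop :=
  exists s : seq R,
    [/\ path <%R 0 s, last 0 s = 1, forall x, x \in s -> triadic x &
        forall i : nat, (i < size s)%N ->
          exists (k : int) (c : R), forall t : R,
            nth 0 (0 :: s) i <= t <= nth 0 (0 :: s) i.+1 ->
            f (circle_pi t) = circle_pi (3 ^ k * t + c)].

Definition T3 : set (homeo circle) :=
  [set f | triadic_piecewise_linear f /\
           forall x : R, triadic x ->
             exists2 y : R, triadic y & f (circle_pi x) = circle_pi y].

End Circle.

Inductive bintree := Leaf | Node of bintree & bintree.

Fixpoint nleaves (t : bintree) : nat :=
  if t is Node l r then (nleaves l + nleaves r)%N else 1%N.

(* Endpoints of the half-open intervals of the leaves, from left to right,
   when [a, b) is associated with the root. *)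
Fixpoint leaf_intervals (R : realType) (t : bintree) (a b : R) : seq (R * R) :=
  if t is Node l r then
    leaf_intervals l a ((a + b) / 2) ++ leaf_intervals r ((a + b) / 2) b
  else [:: (a, b)].

(* Leaves are numbered from 0, so in a triple (S, S', n) with m leaves, leaf i
   of S is identified with leaf i + n - 1 mod m of S'. *)
Definition leaf_match (m n i : nat) : nat := ((i + n.-1) %% m)%N.

Definition represents (R : realType) (S S' : bintree) (n : nat)
    (f : circle R -> circle R) : Prop :=
  [/\ nleaves S = nleaves S', (1 <= n <= nleaves S)%N &
      forall i : nat, (i < nleaves S)%N ->
        let: (a, b) := nth (0, 0) (leaf_intervals S 0 1) i in
        let: (c, d) :=
          nth (0, 0) (leaf_intervals S' 0 1) (leaf_match (nleaves S) n i) in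
        forall t : R, a <= t < b ->
          f (circle_pi t) = circle_pi (c + (d - c) / (b - a) * (t - a))].

(* The numbers i such that leaves i and i + 1 of t are the children of a
   caret, where the leaves of t are numbered from k. *)
Fixpoint leaf_carets (t : bintree) (k : nat) : seq nat :=
  match t with
  | Leaf => [::]
  | Node Leaf Leaf => [:: k]
  | Node l r => leaf_carets l k ++ leaf_carets r (k + nleaves l)%N
  end.

Definition reduced (S S' : bintree) (n : nat) : Prop :=
  ~ exists i j : nat,
    [/\ i \in leaf_carets S 0, j \in leaf_carets S' 0,
        leaf_match (nleaves S) n i = j &
        leaf_match (nleaves S) n i.+1 = j.+1].

(* Each non-leaf vertex joins the leftmost leaf below its left child to the
   leftmost leaf below its right child (leaves numbered from k). *)
Fixpoint thompson_edges (t : bintree) (k : nat) : seq (nat * nat) :=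
  if t is Node l r then
    (k, k + nleaves l)%N ::
      thompson_edges l k ++ thompson_edges r (k + nleaves l)%N
  else [::].

Definition tree_thompson_graph (t : bintree) (i j : nat) : bool :=
  ((i, j) \in thompson_edges t 0) || ((j, i) \in thompson_edges t 0).

(* Vertices are named after those of the Thompson graph of S. *)
Definition thompson_graph (S S' : bintree) (n : nat) : rel 'I_(nleaves S) :=
  fun i j => tree_thompson_graph S i j ||
    tree_thompson_graph S' (leaf_match (nleaves S) n i)
                           (leaf_match (nleaves S) n j).

Definition bipartite (V : finType) (e : rel V) : Prop :=
  exists c : V -> bool, forall x y : V, e x y -> c x != c y.

Definition thompsonT (R : realType) : set (homeo (circle R)) :=
  [set f | exists (S S' : bintree) (n : nat), represents S S' n f].

Definition vecT (R : realType) : set (homeo (circle R)) :=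
  [set f | thompsonT f /\ exists (S S' : bintree) (n : nat),
     [/\ represents S S' n f, reduced S S' n &
         bipartite (@thompson_graph S S' n)]].

(* Main.v *)
(* Let f in T_3 satisfy f^2 = 1 and write f(0) = y = j0 / 3^L with 0 <= y < 1. On
   each arc [j/3^L, (j+1)/3^L], with L large, f is affine onto an arc of length
   1/3^e. Ternary fractions p/3^k have a well defined parity, that of p, and every
   such length is odd. So the lift F of f with F(0) = y maps y, which lies j0 arcs
   to the right of 0, to a number of parity j0 + j0, that is, even. But F(y) is an
   integer in [y, y + 1), as f(y) = f(f(0)) = 0; hence F(y) = 0 and y = 0. Then F is
   an increasing involution of [0, 1), so it is the identity. On the other hand, the
   half turn, represented by a pair of carets with n = 2, is an element of order two
   of the bipartite subgroup. *)
Require Import Defs.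
From mathcomp Require Import all_boot all_order all_algebra.
From mathcomp Require Import all_classical all_reals all_analysis.
From mathcomp Require Import generic_quotient ring lra zify.

Set Implicit Arguments.
Unset Strict Implicit.
Unset Printing Implicit Defensive.

Section TriadicCircle.
Import Order.TTheory GRing.Theory Num.Theory.
Local Open Scope ring_scope.
Local Open Scope quotient_scope.

(** Finitely many thresholds have a maximum. This yields one level fine enough for all pieces of a
    subdivision. *)
Lemma eventually_forall_lt (n : nat) (Q : nat -> nat -> Prop) :
  (forall i, (i < n)%N -> exists m, forall l, (m <= l)%N -> Q i l) ->
  exists m, forall l, (m <= l)%N -> forall i, (i < n)%N -> Q i l.
Proof.
elim: n => [_|n IHn H]; first by exists 0%N.
have [|m1 H1] := IHn; first by move=> i ltin; apply: H; exact: ltnW.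
have [m2 H2] := H n (ltnSn n).
exists (maxn m1 m2) => l; rewrite geq_max => /andP[l1 l2] i.
by rewrite ltnS leq_eqVlt => /predU1P[->|/H1]; [exact: H2|exact].
Qed.

Variable R : realType.
Implicit Types (x y z : R) (f g : circle R -> circle R).

Lemma nth_bracket x0 a (s : seq R) x : a <= x < last a s ->
  exists2 i, (i < size s)%N & nth x0 (a :: s) i <= x < nth x0 (a :: s) i.+1.
Proof.
elim: s a => [|b s IHs] a /=.
  by case/andP => /le_lt_trans/[apply]; rewrite ltxx.
case/andP=> ax xs; have [xb|bx] := ltP x b; first by exists 0%N; rewrite //= ax.
have [|i ilt xi] := IHs b; first by rewrite bx.
by exists i.+1.
Qed.

(** * Points of the circle and triadic rationals *)

Lemma circle_piP x y :
  reflect (circle_pi x = circle_pi y) (x - y \is a Num.int).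
Proof. exact: (@eqmodP R (circle_equiv R)). Qed.

Lemma circle_piDz x (n : int) : circle_pi (x + n%:~R) = circle_pi x.
Proof. by apply/circle_piP; rewrite addrAC subrr add0r intr_int. Qed.

Lemma circle_piDr x y z :
  circle_pi x = circle_pi y -> circle_pi (x + z) = circle_pi (y + z).
Proof.
move/circle_piP => xy; apply/circle_piP.
by rewrite opprD addrACA subrr addr0.
Qed.

Lemma circle_pi_ex (p : circle R) : exists2 x, 0 <= x < 1 & p = circle_pi x.
Proof.
have ->: p = circle_pi (repr (p : {eq_quot circle_equiv R})).
  by rewrite /circle_pi reprK.
set x := repr _.
exists (x - (Num.floor x)%:~R); last by rewrite -mulrNz circle_piDz.
have := floor_itv x; rewrite intrD; lra.
Qed.

Lemma circle_pi_inj x y :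
  0 <= x < 1 -> 0 <= y < 1 -> circle_pi x = circle_pi y -> x = y.
Proof.
move=> x01 y01 /circle_piP/intrP[n xyn].
suff n0 : n = 0 by move: xyn; rewrite n0; lra.
have : (-1)%:~R < n%:~R :> R by rewrite -xyn; lra.
have : n%:~R < 1%:~R :> R by rewrite -xyn; lra.
by rewrite !ltr_int; lia.
Qed.

Lemma triadicP x : triadic x <->
  exists m, forall l, (m <= l)%N -> exists p : int, x = p%:~R / 3 ^+ l.
Proof.
split=> [[p [k ->]]|[m /(_ m (leqnn m))[p ->]]]; last by exists p, m.
exists k => l kl; exists (p * 3 ^+ (l - k)).
have -> : (3 : R) ^+ l = 3 ^+ (l - k) * 3 ^+ k by rewrite -exprD subnK.
rewrite intrM rmorphXn /=; field.
by rewrite !expf_neq0// pnatr_eq0.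
Qed.

Lemma triadicB x y : triadic x -> triadic y -> triadic (x - y).
Proof.
move=> /triadicP[m xm] /triadicP[n yn].
have [|p xE] := xm (maxn m n); first exact: leq_maxl.
have [|q yE] := yn (maxn m n); first exact: leq_maxr.
by exists (p - q), (maxn m n); rewrite xE yE intrB mulrBl.
Qed.

Lemma triadic_int (n : int) : triadic (n%:~R : R).
Proof. by exists n, 0%N; rewrite expr0 divr1. Qed.

Lemma triadicMX x (k : int) : triadic x -> triadic (3 ^ k * x).
Proof.
move=> [p [l ->]]; case: k => k.
  exists (3 ^+ k * p), l.
  by rewrite intrM rmorphXn /= mulrA.
exists p, (l + k.+1)%N; have -> : (3 : R) ^ Negz k = (3 ^+ k.+1)^-1 by [].
by rewrite exprD; field; rewrite !expf_neq0 ?pnatr_eq0.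
Qed.

(** * Affine maps between triadic arcs *)

Lemma exp3_gt0 l : 0 < 3 ^+ l :> R.
Proof. by rewrite exprn_gt0. Qed.

Lemma exp3_ge0 l : 0 <= 3 ^+ l :> R.
Proof. exact/ltW/exp3_gt0. Qed.

Lemma exp3_neq0 l : 3 ^+ l != 0 :> R.
Proof. by rewrite gt_eqF// exp3_gt0. Qed.

Lemma exp3z l l' (k : int) : l%:Z - k = l'%:Z -> 3 ^ k = 3 ^+ l / 3 ^+ l' :> R.
Proof.
move=> lk; have -> : k = l%:Z - l'%:Z by lia.
by rewrite expfzDr ?pnatr_eq0// -exprnP -invr_expz.
Qed.

(* [f] maps the triadic arc [[j / 3 ^ l, (j + 1) / 3 ^ l]] affinely onto
   [[j' / 3 ^ l', (j' + 1) / 3 ^ l']]. *)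
Definition maps_arc f (l : nat) (j : int) (l' : nat) (j' : int) : Prop :=
  forall u : R, 0 <= u <= 1 ->
    f (circle_pi ((j%:~R + u) / 3 ^+ l)) = circle_pi ((j'%:~R + u) / 3 ^+ l').

(** A description of $T_3$ without subdivisions. Since the level [l'] of the image arcs can be
    forced above any [n], these arcs are fine enough for a second map, which gives closure under
    composition. *)
Definition refinable f : Prop := forall n, exists m, forall l (j : int),
  (m <= l)%N -> exists l' j', (n <= l')%N /\ maps_arc f l j l' j'.

Lemma refinable_comp f g : refinable f -> refinable g -> refinable (f \o g).
Proof.
move=> rf rg n; have [m fm] := rf n; have [k gk] := rg m.
exists k => l j /(gk l j)[l1 [j1 [/(fm l1 j1)[l2 [j2 [nl2 f2]]] g1]]].
by exists l2, j2; split => // u u01 /=; rewrite g1 ?f2.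
Qed.

(** At a fine enough level, all endpoints of the subdivision lie on the grid, so each arc stays
    inside one piece; slope $3^k$ then lowers the level by $k$. *)
Lemma T3_refinable (f : homeo (circle R)) : T3 f -> refinable f.
Proof.
case=> -[s [s0 s1 s3 sf]] f3 n.
have t3 i : (i <= size s)%N -> triadic (nth 0 (0 :: s) i).
  by case: i => [_|i lti /=]; [exact: (triadic_int 0)|apply/s3/mem_nth].
pose t := nth 0 (0 :: s).
pose Q i l := exists p q : int, [/\ t i = p%:~R / 3 ^+ l,
  t i.+1 = q%:~R / 3 ^+ l & exists (l' : nat) (c : int), (n <= l')%N /\
  forall x, t i <= x <= t i.+1 ->
    f (circle_pi x) = circle_pi ((3 ^+ l * x + c%:~R) / 3 ^+ l')].
have [|m Qm] := @eventually_forall_lt (size s) Q.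
  move=> i ltis; have [k [c fE]] := sf i ltis.
  have /triadicP[m1 H1] := t3 i (ltnW ltis).
  have /triadicP[m2 H2] := t3 i.+1 ltis.
  have ti_le : t i <= t i.+1 by move/(pathP 0): s0 => /(_ i ltis)/ltW.
  (* Modulo 1, [c] is $y - 3^k t_i$, where the triadic [y] represents the image of the endpoint
     $t_i$. *)
  have tc : triadic c.
    have [y ty] := f3 _ (t3 i (ltnW ltis)).
    rewrite fE ?lexx// => /circle_piP/intrP[z cE].
    have -> : c = y - 3 ^ k * t i - (- z)%:~R.
      by rewrite mulrNz -cE -/(t i); move: (3 ^ k * t i) => w; ring.
    apply: triadicB; last exact: triadic_int.
    by apply: triadicB => //; apply/triadicMX/t3/ltnW.
  have /triadicP[m3 H3] := tc.
  (* The summand [|k|] ensures that $l - k$ is still at least [n] and [m3], so it can serve as [l']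
     and as a level for [c]. *)
  exists (maxn (maxn m1 m2) (maxn n m3 + `|k|)%N) => l.
  rewrite !geq_max => /andP[/andP[/H1[p pE] /H2[q qE]] nkl].
  have [l' [nl' lk]] : exists l' : nat, (maxn n m3 <= l')%N /\ l%:Z - k = l'%:Z.
    by exists `|l%:Z - k|%N; lia.
  move: nl'; rewrite geq_max => /andP[nl' /H3[d dE]].
  exists p, q; split => //; exists l', d; split => // x x01.
  rewrite fE// (exp3z lk) dE; congr circle_pi; field; exact: exp3_neq0.
exists m => l j /Qm{}Qm.
have N0 : (3 : int) ^+ l != 0 by rewrite expf_neq0.
(* Integer translation brings the arc into $[0, 1]$, where the subdivision lives. *)
pose r := (j %% 3 ^+ l)%Z.
have r0 : 0 <= r by exact: modz_ge0.
have rl : r < 3 ^+ l by apply: ltz_pmod; rewrite exprn_gt0.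
have jE u : (j%:~R + u) / 3 ^+ l = (r%:~R + u) / 3 ^+ l + ((j %/ 3 ^+ l)%Z)%:~R :> R.
  rewrite {1}(divz_eq j (3 ^+ l)) -/r intrD intrM rmorphXn /=.
  by field; exact: exp3_neq0.
have [|i ltis /andP[ir ri]] := @nth_bracket 0 0 s (r%:~R / 3 ^+ l).
  rewrite s1 ltr_pdivrMr ?exp3_gt0// mul1r divr_ge0 ?ler0z//= ?exp3_ge0//.
  by rewrite -(ltr_int R) rmorphXn in rl.
have [p [q [pE qE [l' [c [nl' fE]]]]]] := Qm i ltis.
(* As [r] and [q] are integers, an arc that starts before the end of the piece also ends in it. *)
have rq : r + 1 <= q.
  move: ri; rewrite -/t qE ltr_pM2r ?invr_gt0 ?exp3_gt0// ltr_int; lia.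
exists l', (r + c); split => // u /andP[u0 u1].
rewrite jE circle_piDz fE; last first.
  apply/andP; split.
    by apply: le_trans ir _; rewrite ler_pM2r ?invr_gt0 ?exp3_gt0//; lra.
  rewrite qE ler_pM2r ?invr_gt0 ?exp3_gt0//.
  by move: rq; rewrite -(ler_int R) intrD; lra.
congr circle_pi; rewrite intrD; field.
by rewrite !exp3_neq0.
Qed.

(** The grid of step $3^{-m}$ is a subdivision: an arc of level [m] sent to one of level [l] gives
    slope $3^{m-l}$. *)
Lemma refinable_T3 (f : homeo (circle R)) : refinable f -> T3 f.
Proof.
move=> rf; split; last first.
  move=> x /triadicP[m xm]; have [k fk] := rf 0%N.
  have [p xE] := xm (maxn m k) (leq_maxl _ _).
  have [l [j [_ fE]]] := fk (maxn m k) p (leq_maxr _ _).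
  exists (j%:~R / 3 ^+ l); first by exists j, l.
  by have := fE 0; rewrite !addr0 -xE; apply; rewrite lexx ler01.
have [m fm] := rf 0%N.
pose t (i : nat) : R := i%:R / 3 ^+ m.
have tE : 0 :: [seq t i | i <- iota 1 (3 ^ m)] = [seq t i | i <- iota 0 (3 ^ m).+1].
  by rewrite /=; congr (_ :: _); rewrite /t mul0r.
have t_nth i : (i <= 3 ^ m)%N -> nth 0 (0 :: [seq t i | i <- iota 1 (3 ^ m)]) i = t i.
  by move=> im; rewrite tE (nth_map 0%N) ?size_iota// nth_iota.
exists [seq t i | i <- iota 1 (3 ^ m)]; split.
- suff : sorted <%R (0 :: [seq t i | i <- iota 1 (3 ^ m)]) by [].
  rewrite tE; apply: (homo_sorted (e := ltn)); last exact: iota_ltn_sorted.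
  by move=> i j ij; rewrite ltr_pM2r ?invr_gt0 ?exp3_gt0// ltr_nat.
- rewrite (last_nth 0) size_map size_iota t_nth// /t natrX divff//.
- by move=> x /mapP[i _ ->]; exists i%:Z, m.
rewrite size_map size_iota => i im; rewrite !t_nth ?(ltnW im)//.
have [l [j [_ fE]]] := fm m i (leqnn m).
exists (m%:Z - l%:Z), ((j%:~R - i%:R) / 3 ^+ l) => x /andP[].
rewrite {1}/t ler_pdivrMr ?exp3_gt0// /t ler_pdivlMr ?exp3_gt0// -(natr1 i) => ix xi.
have := fE (x * 3 ^+ m - i%:R).
rewrite -pmulrn [i%:R + _]addrC subrK mulfK ?exp3_neq0// => ->; last lra.
rewrite (@exp3z m l); last lia.
by congr circle_pi; field; rewrite exp3_neq0.
Qed.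

Lemma T3_mul (f g : homeo (circle R)) : T3 f -> T3 g -> T3 (f * g)%g.
Proof.
move=> /T3_refinable rf /T3_refinable rg; apply: refinable_T3.
exact: (refinable_comp rf rg).
Qed.

Lemma T3_one : T3 (1%g : homeo (circle R)).
Proof. by apply: refinable_T3 => n; exists n => l j nl; exists l, j. Qed.

(** * Parity of ternary fractions, and involutions in $T_3$ *)

Lemma exp3_odd l : exists q : int, 3 ^+ l = 2 * q + 1.
Proof.
elim: l => [|l [q qE]]; first by exists 0; rewrite expr0 mulr0 add0r.
by exists (3 * q + 1); rewrite exprS qE; ring.
Qed.

(** Over a common denominator, each term $3^{-e}$ has an odd numerator, and rescaling by a power of
    3 keeps the parity of the others. *)
Lemma triadic_sum_parity (j0 : int) L (e : nat -> nat) j :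
  exists K (q : int),
    j0%:~R / 3 ^+ L + \sum_(i < j) (3 ^+ e i)^-1 =
    (j0 + j%:Z + 2 * q)%:~R / 3 ^+ K :> R.
Proof.
elim: j => [|j [K [q IHj]]]; first by exists L, 0; rewrite big_ord0 mulr0 !addr0.
rewrite big_ord_recr /= addrA IHj.
have [x xE] := exp3_odd (e j); have [y yE] := exp3_odd K.
exists (K + e j)%N, ((j0 + j%:Z + 2 * q) * x + q + y).
have -> : j0 + j.+1%:Z + 2 * ((j0 + j%:Z + 2 * q) * x + q + y) =
    (j0 + j%:Z + 2 * q) * 3 ^+ e j + 3 ^+ K.
  by rewrite xE yE -addn1 PoszD; ring.
rewrite [in RHS]intrD intrM !rmorphXn /= exprD; field.
by rewrite !exp3_neq0.
Qed.

Lemma T3_involution (f : homeo (circle R)) :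
  T3 f -> (forall p, f (f p) = p) -> forall p, f p = p.
Proof.
move=> T3f ff; have f_inj : injective f := can_inj ff.
have [M fM] := T3_refinable T3f 0%N.
have [L [j0 [ML j0L f0]]] : exists L (j0 : nat),
    [/\ (M <= L)%N, (j0 < 3 ^ L)%N & f (circle_pi 0) = circle_pi (j0%:R / 3 ^+ L)].
  have [y /triadicP[m ym] fy] := T3f.2 0 (triadic_int 0).
  have [p yE] := ym (maxn M m) (leq_maxr _ _).
  set L := maxn M m in yE *.
  have N0 : (3 : int) ^+ L != 0 by rewrite expf_neq0.
  have r0 : 0 <= (p %% 3 ^+ L)%Z by exact: modz_ge0.
  have rl : (p %% 3 ^+ L)%Z < 3 ^+ L by apply: ltz_pmod; rewrite exprn_gt0.
  have rE : (`|(p %% 3 ^+ L)%Z|%N)%:R = (p %% 3 ^+ L)%Z%:~R :> R.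
    by rewrite pmulrn gez0_abs.
  exists L, `|(p %% 3 ^+ L)%Z|%N; split; first exact: leq_maxl.
    by rewrite -ltz_nat gez0_abs // -(natz (3 ^ L)) natrX.
  rewrite fy yE rE -(circle_piDz (_ / _) (p %/ 3 ^+ L)%Z).
  rewrite {1}(divz_eq p (3 ^+ L)) intrD intrM rmorphXn /=.
  by congr circle_pi; field; exact: exp3_neq0.
have /choice[e eP] (j : nat) : exists l', exists j', maps_arc f L j l' j'.
  by have [l' [j' [_ ?]]] := fM L j ML; exists l', j'.
(* The lift of [f] to the real line is affine between the points [j / 3 ^ L], where
   it takes the values [a j]. *)
pose a j : R := j0%:R / 3 ^+ L + \sum_(i < j) (3 ^+ e i)^-1.
have aS j : a j.+1 = a j + (3 ^+ e j)^-1 by rewrite /a big_ord_recr /= addrA.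
have a0 : a 0%N = j0%:R / 3 ^+ L by rewrite /a big_ord0 addr0.
(* The integer [j'] matters only through the image of the left endpoint, which is already known to
   be [a j]. *)
have fa_step j u : f (circle_pi (j%:R / 3 ^+ L)) = circle_pi (a j) ->
    0 <= u <= 1 -> f (circle_pi ((j%:R + u) / 3 ^+ L)) = circle_pi (a j + u / 3 ^+ e j).
  move=> fj u01; have [j' H] := eP j.
  have := H 0; rewrite -pmulrn !addr0 fj lexx ler01 => /(_ isT).
  move=> /(circle_piDr (u / 3 ^+ e j)) ->.
  by rewrite pmulrn H// mulrDl.
have fa j : f (circle_pi (j%:R / 3 ^+ L)) = circle_pi (a j).
  elim: j => [|j IHj]; first by rewrite mul0r f0 a0.
  by rewrite -natr1 (fa_step j 1)// ?lexx ?ler01// aS mul1r.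
have {fa_step}fau j u : 0 <= u <= 1 ->
    f (circle_pi ((j%:R + u) / 3 ^+ L)) = circle_pi (a j + u / 3 ^+ e j).
  by apply: fa_step.
have e0 j : 0 < (3 ^+ e j)^-1 :> R by rewrite invr_gt0 exp3_gt0.
have a_lt i j : (i < j)%N -> a i < a j.
  elim: j => // j IHj; rewrite ltnS leq_eqVlt aS => /predU1P[->|/IHj]; have := e0 j; lra.
have a_le i j : (i <= j)%N -> a i <= a j.
  by rewrite leq_eqVlt => /predU1P[->//|/a_lt/ltW].
have N0 : (0 < 3 ^ L)%N by rewrite expn_gt0.
(* The lift has degree one. Its increment over a turn is a positive integer; were it above 1, the
   value [a 0 + 1] would be taken strictly inside the turn, at a second point with the same image as
   0. *)
have a1 : a (3 ^ L)%N = a 0%N + 1.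
  have /circle_piP/intrP[d dE] : circle_pi (a (3 ^ L)%N) = circle_pi (a 0%N).
    rewrite -!fa natrX divff ?exp3_neq0// mul0r.
    by congr (f _); apply/circle_piP; rewrite subr0 rpred1.
  have d0 : 0 < d by rewrite -(ltr_int R) -dE subr_gt0 a_lt.
  suff d1 : ~ 1 < d by move: dE; (have -> : d = 1 by lia); lra.
  rewrite -(ltr_int R) -dE => d1.
  have [|i] := @nth_bracket 0 (a 0%N) [seq a i | i <- iota 1 (3 ^ L)] (a 0%N + 1).
    rewrite (last_nth 0) size_map size_iota.
    have -> : nth 0 (a 0%N :: [seq a i | i <- iota 1 (3 ^ L)]) (3 ^ L) = a (3 ^ L)%N.
      by rewrite -[_ :: _]/[seq a i | i <- iota 0 (3 ^ L).+1] (nth_map 0%N) ?size_iota//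
        nth_iota.
    lra.
  rewrite size_map size_iota => iL.
  rewrite -[a 0%N :: _]/[seq a i | i <- iota 0 (3 ^ L).+1].
  rewrite !(nth_map 0%N) ?size_iota ?ltnS ?(ltnW iL)// !nth_iota ?ltnS ?(ltnW iL)//.
  rewrite !add0n aS.
  move=> /andP[ai1 ai2].
  set u := (a 0%N + 1 - a i) * 3 ^+ e i.
  have u0 : 0 <= u by rewrite mulr_ge0 ?exp3_ge0//; lra.
  have u1 : u < 1 by rewrite -ltr_pdivlMr ?exp3_gt0// div1r; lra.
  have := fau i u; rewrite u0 ltW// => /(_ isT).
  rewrite mulfK ?exp3_neq0// addrCA subrr addr0 (circle_piDz _ 1) -fa mul0r.
  move=> /f_inj/circle_pi_inj.
  have iL' : i%:R + 1 <= 3 ^+ L :> R by rewrite natr1 -natrX ler_nat.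
  rewrite divr_ge0 ?exp3_ge0// ?addr_ge0//= ltr_pdivrMr ?exp3_gt0// lexx ltr01.
  move=> /(_ _ isT) H.
  have /eqP : (i%:R + u) / 3 ^+ L = 0 by apply: H; lra.
  rewrite mulf_eq0 invr_eq0 (negPf (exp3_neq0 _)) orbF => /eqP iu.
  have i0 : i = 0%N by apply/eqP; rewrite -(eqr_nat R) eq_le ler0n andbT; lra.
  move: iu; rewrite /u i0 add0r addrAC subrr add0r mul1r => /eqP.
  by rewrite (negPf (exp3_neq0 _)).
have j00 : a 0%N = 0.
  have /circle_piP : circle_pi (a j0) = circle_pi 0 by rewrite -fa -f0 ff.
  rewrite subr0 => /intrP[n nE].
  have a0_ge0 : 0 <= a 0%N by rewrite a0 divr_ge0 ?exp3_ge0.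
  have a0_lt1 : a 0%N < 1.
    by rewrite a0 ltr_pdivrMr ?exp3_gt0// mul1r -natrX ltr_nat.
  (* The bounds $a_0 \le a_{j_0} < a_0 + 1 < 2$ leave [n] equal to 0 or 1, and $n 3^K$ is even. *)
  have a0j := a_le 0%N j0 (leq0n _).
  have aj1 := a_lt _ _ j0L.
  have n0 : -1 < n by rewrite -(ltr_int R) -nE; lra.
  have n2 : n < 2 by rewrite -(ltr_int R) -nE; lra.
  have [K [q]] := triadic_sum_parity j0 L e j0.
  rewrite -[LHS]/(a j0) nE => nK.
  have : n%:~R * 3 ^+ K = (j0%:Z + j0%:Z + 2 * q)%:~R :> R.
    by rewrite nK divfK ?exp3_neq0.
  have -> : (3 : R) ^+ K = (3 ^+ K : int)%:~R by rewrite rmorphXn.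
  rewrite -intrM => /(intr_inj (R := R)); have [y ->] := exp3_odd K => nq.
  suff n00 : n = 0 by move: nE; rewrite n00; lra.
  suff : n <> 1 by lia.
  by move=> n1; move: nq; rewrite n1; lia.
(* The lift as a real function. As it runs from 0 to 1 over a turn, it preserves $[0, 1)$, so
   [F (F x) = x] holds exactly and not only modulo 1. *)
pose F x := a (Num.truncn (x * 3 ^+ L)) +
  (x * 3 ^+ L - (Num.truncn (x * 3 ^+ L))%:R) / 3 ^+ e (Num.truncn (x * 3 ^+ L)).
have F_itv x : 0 <= x ->
    a (Num.truncn (x * 3 ^+ L)) <= F x < a (Num.truncn (x * 3 ^+ L)).+1.
  move=> x0; have := @truncn_itv _ (x * 3 ^+ L); rewrite mulr_ge0 ?exp3_ge0//.
  move=> /(_ isT); rewrite aS /F; set j := Num.truncn _; rewrite -(natr1 j) => jx.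
  rewrite lerDl ltrD2l divr_ge0 ?exp3_ge0//=; last lra.
  by rewrite -[ltRHS]mul1r ltr_pM2r//; lra.
have trunc_lt x : 0 <= x < 1 -> (Num.truncn (x * 3 ^+ L) < 3 ^ L)%N.
  case/andP => x0 x1; rewrite truncn_lt_nat ?mulr_ge0 ?exp3_ge0// natrX.
  by rewrite gtr_pMl// exp3_gt0.
have F01 x : 0 <= x < 1 -> 0 <= F x < 1.
  move=> /[dup] x01 /trunc_lt/a_le; rewrite a1 j00.
  have /andP[/F_itv/andP[Fx1 Fx2] _] := x01.
  have := a_le 0%N _ (leq0n (Num.truncn (x * 3 ^+ L))); lra.
have F_lt x y : 0 <= x -> x < y -> F x < F y.
  move=> x0 xy; have y0 : 0 <= y by lra.
  have xyL : x * 3 ^+ L < y * 3 ^+ L by rewrite ltr_pM2r ?exp3_gt0.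
  have := le_truncn (ltW xyL); rewrite leq_eqVlt => /predU1P[xyE|].
    by rewrite /F -xyE ltrD2l ltr_pM2r// ltrD2r.
  move=> /a_le; have /andP[_] := F_itv x x0; have /andP[+ _] := F_itv y y0; lra.
have Ff x : 0 <= x < 1 -> f (circle_pi x) = circle_pi (F x).
  move=> x01; rewrite /F; set j := Num.truncn _.
  rewrite -fau ?[_%:R + _]addrC ?subrK ?mulfK ?exp3_neq0//.
  have := @truncn_itv _ (x * 3 ^+ L); rewrite mulr_ge0 ?exp3_ge0//; last lra.
  by move=> /(_ isT); rewrite -/j -(natr1 j); lra.
have FF x : 0 <= x < 1 -> F (F x) = x.
  move=> x01; apply: circle_pi_inj; rewrite ?F01//.
  by rewrite -Ff ?F01// -Ff// ff.
move=> p; have [x x01 ->] := circle_pi_ex p; rewrite Ff//.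
congr circle_pi; have := FF x x01; have := F01 x x01.
(* If $x < F(x)$, monotonicity gives $F(x) < F(F(x)) = x$; the other case is symmetric. *)
have [xF|Fx|//] := ltgtP x (F x) => Fx01 FFx.
  by have := F_lt x (F x); lra.
by have := F_lt (F x) x; lra.
Qed.

Lemma T3_no_order_two (f : homeo (circle R)) : T3 f -> (f ^+ 2 = 1)%g -> f = 1%g.
Proof.
rewrite expgS expg1 => T3f ff; apply: homeo_inj; apply: T3_involution => // p.
exact: (congr1 (fun h : homeo (circle R) => h p) ff).
Qed.

(** * The half turn as an element of order two of $\vec T$ *)

Definition half_turn_fun (p : circle R) : circle R :=
  circle_pi (repr (p : {eq_quot circle_equiv R}) + 2^-1).

Lemma half_turn_funE x : half_turn_fun (circle_pi x) = circle_pi (x + 2^-1).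
Proof. by apply: circle_piDr; exact: reprK. Qed.

Lemma half_turn_funK : involutive half_turn_fun.
Proof.
move=> p; have [x _ ->] := circle_pi_ex p; rewrite !half_turn_funE -addrA.
have -> : 2^-1 + 2^-1 = 1%:~R :> R by lra.
by rewrite circle_piDz.
Qed.

Lemma half_turn_fun_continuous : continuous half_turn_fun.
Proof.
apply/quotient_continuous.
have -> : half_turn_fun \o \pi_(quotient_topology {eq_quot circle_equiv R}) =
    (@circle_pi R) \o (fun x => x + 2^-1).
  by apply: funext => x; exact: half_turn_funE.
move=> x; apply: continuous_comp; last exact: pi_continuous.
exact: (cvgD cvg_id (cvg_cst _)).
Qed.

Lemma half_turn_homeomorphism : homeomorphism half_turn_fun.
Proof.
by exists half_turn_fun; split; [exact: half_turn_funK|exact: half_turn_funK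
  |exact: half_turn_fun_continuous|exact: half_turn_fun_continuous].
Qed.

Definition half_turn : homeo (circle R) := Homeo half_turn_homeomorphism.

Lemma half_turn_sqr : (half_turn * half_turn = 1)%g.
Proof. by apply: homeo_inj => p; exact: half_turn_funK. Qed.

Lemma half_turn_neq1 : half_turn <> 1%g.
Proof.
move=> /(congr1 (fun h : homeo (circle R) => h (circle_pi 0))).
rewrite [LHS]half_turn_funE add0r => /circle_pi_inj; lra.
Qed.

Lemma half_turn_represents :
  represents (Node Leaf Leaf) (Node Leaf Leaf) 2 half_turn.
Proof.
split=> // -[|[|//]] _ /= t t01; rewrite half_turn_funE.
  by congr circle_pi; field.
(* The second half lands in $[1, 3/2)$, one turn beyond the interval of the first leaf. *)
rewrite -[RHS](circle_piDz _ 1) (_ : 1%:~R = 1 :> R)//; congr circle_pi; field; lra.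
Qed.

Lemma half_turn_vecT : vecT half_turn.
Proof.
split.
  by exists (Node Leaf Leaf), (Node Leaf Leaf), 2%N; exact: half_turn_represents.
exists (Node Leaf Leaf), (Node Leaf Leaf), 2%N; split.
- exact: half_turn_represents.
(* Both carets start at leaf 0, but leaf 0 is identified with leaf 1. *)
- by move=> [i [j [/=]]]; rewrite !inE => /eqP -> /eqP ->.
- by exists (fun i : 'I__ => val i == 0%N) => -[[|[|//]] ?] [[|[|//]] ?].
Qed.

End TriadicCircle.

Theorem proposition23 (R : realType) :
  (~ exists2 f : homeo (circle R), T3 f & has_order 2 f) /\
  ~ isomorphic (@T3 R) (@vecT R).
Proof.
split=> [[f T3f [f2 /(_ 1%N isT)]]|[phi [[_ phi_inj phi_surj] phiM]]].
  by rewrite expg1 (T3_no_order_two T3f f2).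
have phi1 : phi 1%g = 1%g.
  by have := phiM _ _ (T3_one R) (T3_one R); rewrite mulg1 -[LHS]mulg1 => /mulgI.
(* By injectivity of [phi], the preimage [f] of the half turn squares to 1. Hence [f] is 1, and so
   is the half turn. *)
have [f T3f phif] := phi_surj _ (half_turn_vecT R).
apply: (@half_turn_neq1 R); rewrite -phif (T3_no_order_two T3f) ?phi1//.
rewrite expgS expg1; apply: phi_inj; rewrite ?inE.
- exact: T3_mul.
- exact: T3_one.
- by rewrite phiM// phif phi1 half_turn_sqr.
Qed.
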